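(* Let $c\ge\frac12$ and $\varrho>0$, and let $(\xi_s,\dot\xi_s)=(t_s,x_s,\dot t_s,\dot x_s)$ be the $R$-diffusion (with parameter $\varrho$) in the Einstein–de Sitter-like manifold $\mathcal M=(0,\infty)\times\mathbb R^3$, $g=dt^2-t^{2c}|dx|^2$. Then, almost surely as $s\to\infty$, $\dot t_s\to1$ and the energy $\mathcal E_s=\mathcal E(\xi_s,\dot\xi_s)$ goes to $0$.
   Context: $\mathcal M=(0,\infty)\times\mathbb R^3$ with coordinates $\xi=(t,x)$ and Lorentz metric $g=dt^2-t^{2c}|dx|^2$. $T^1\mathcal M$ is the set of $(\xi,\dot\xi)=(t,x,\dot t,\dot x)$ with $\dot t^2-t^{2c}|\dot x|^2=1$, $\dot t\ge1$. The scalar curvature is $R=-6c(2c-1)t^{-2}$ (non-positive for $c\ge\frac12$). The energy is $\mathcal E(\xi,\dot\xi)=\mathrm{Ricci}(\dot\xi,\dot\xi)-\frac12R=c\,t^{-2}(2\dot t^2+3c-2)$. The $R$-diffusion with parameter $\varrho>0$ is the $T^1\mathcal M$-valued diffusion $(\xi_s,\dot\xi_s)$ (started from any point of $T^1\mathcal M$, $s$ being proper time) with generator $\mathcal L^0+\frac12\nabla^v\,\Xi\,\nabla^v$, $\Xi=-\varrho^2R$, where $\mathcal L^0$ generates the geodesic flow and $\nabla^v$ is the gradient on the fibre $T^1_\xi\mathcal M$ with its hyperbolic metric (restriction of $-g(\xi)$). Equivalently $d\xi_s=\dot\xi_s\,ds$ and, in Itô form, $$d\dot\xi^k_s=\varrho\,dM^k_s+9c(2c-1)\varrho^2\,t_s^{-2}\,\dot\xi^k_s\,ds-\Gamma^k_{ij}(\xi_s)\dot\xi^i_s\dot\xi^j_s\,ds,$$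 with $\varrho^{-2}[d\dot\xi^k_s,d\dot\xi^\ell_s]=6c(2c-1)[\dot\xi^k_s\dot\xi^\ell_s-g^{k\ell}(\xi_s)]\,t_s^{-2}ds$ for $0\le k,\ell\le3$; the nonzero Christoffel symbols are $\Gamma^0_{ij}=c\,t^{2c-1}\delta_{ij}$, $\Gamma^j_{0i}=\Gamma^j_{i0}=c\,t^{-1}\delta_{ij}$ ($1\le i,j\le3$). In particular, for some standard real Brownian motion $w$, $$d\dot t_s=\frac{\varrho}{t_s}\sqrt{6c(2c-1)(\dot t_s^2-1)}\,dw_s+\frac{9\varrho^2c(2c-1)}{t_s^2}\dot t_s\,ds-\frac{c}{t_s}(\dot t_s^2-1)\,ds .$$ *)

(* Defs.v *)
From HB Require Import structures.
From mathcomp Require Import all_boot all_order all_algebra.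
From mathcomp Require Import ring lra.
From mathcomp Require Import all_classical all_reals all_analysis.

Set Implicit Arguments.
Unset Strict Implicit.
Unset Printing Implicit Defensive.

Import Order.TTheory GRing.Theory Num.Theory.
Import numFieldNormedType.Exports.

Local Open Scope classical_set_scope.
Local Open Scope ring_scope.

(* Coordinates on an open subset of R^4 are row vectors 'rV[R]_4; index
   [ord0] is time and the indices [i != ord0] are space. *)
Section LorentzGeometry.
Variable R : realType.
Implicit Types (G : 'rV[R]_4 -> 'M[R]_4) (xi v : 'rV[R]_4) (i j k : 'I_4).

Definition partial i (f : 'rV[R]_4 -> R) xi : R := 'D_(delta_mx 0 i) f xi.

Definition christoffel G k i j xi : R :=
  2^-1 * \sum_(l < 4) invmx (G xi) k l *
    (partial i (fun y => G y j l) xi + partial j (fun y => G y i l) xi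
     - partial l (fun y => G y i j) xi).

(* Sign convention: the Ricci tensor of a round sphere is positive. *)
Definition ricci G i j xi : R :=
  \sum_(k < 4) (partial k (christoffel G k i j) xi
                - partial j (christoffel G k i k) xi)
  + \sum_(k < 4) \sum_(l < 4)
      (christoffel G k k l xi * christoffel G l i j xi
       - christoffel G k j l xi * christoffel G l i k xi).

Definition scalar_curvature G xi : R :=
  \sum_(i < 4) \sum_(j < 4) invmx (G xi) i j * ricci G i j xi.

Definition energy G xi v : R :=
  (\sum_(i < 4) \sum_(j < 4) ricci G i j xi * v 0 i * v 0 j)
  - 2^-1 * scalar_curvature G xi.

Definition time xi : R := xi 0 ord0.

(* dt^2 - t^(2c) |dx|^2; meaningful where [0 < time xi]. *)
Definition eds_metric (c : R) xi : 'M[R]_4 :=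
  diag_mx (\row_i (if i == ord0 then 1 else - (time xi `^ (2 * c)))).

Definition eds_unit_tangent (c : R) : set ('rV[R]_4 * 'rV[R]_4) :=
  [set p : 'rV[R]_4 * 'rV[R]_4 | [/\ 0 < time p.1,
    p.2 0 ord0 ^+ 2 - time p.1 `^ (2 * c) * (\sum_(i | i != ord0) p.2 0 i ^+ 2)
      = 1
    & 1 <= p.2 0 ord0]].

End LorentzGeometry.

(* Processes are indexed by real times, of which only [0 <= s] matter. *)
Section ContinuousLocalMartingales.
Context d (T : measurableType d) (R : realType) (P : probability T R).
Implicit Types (F : R -> set (set T)) (X Y : R -> T -> R).

Definition filtration F : Prop :=
  [/\ forall s, 0 <= s -> sigma_algebra setT (F s),
      forall s, 0 <= s -> F s `<=` measurable
    & forall s u, 0 <= s -> s <= u -> F s `<=` F u].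

Definition adapted F X : Prop :=
  forall s, 0 <= s -> forall B, measurable B -> F s (X s @^-1` B).

Definition continuous_paths (V : topologicalType) (X : R -> T -> V) : Prop :=
  forall w, {within `[0, +oo[, continuous (X ^~ w)}.

(* The last condition is E[X_u | F_s] = X_s. *)
Definition martingale F X : Prop :=
  [/\ adapted F X,
      forall s, 0 <= s -> P.-integrable setT (EFin \o X s)
    & forall s u, 0 <= s -> s <= u -> forall A, F s A ->
        (\int[P]_(w in A) (X u w)%:E = \int[P]_(w in A) (X s w)%:E)%E].

Definition stopping_time F (tau : T -> \bar R) : Prop :=
  (forall w, 0 <= tau w)%E /\
  (forall s, 0 <= s -> F s [set w | tau w <= s%:E]%E).

Definition stopped X (tau : T -> \bar R) : R -> T -> R :=
  fun s w => X (fine (Order.min s%:E (tau w))) w.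

Definition continuous_local_martingale F X : Prop :=
  [/\ adapted F X, continuous_paths X
    & exists tau : nat -> T -> \bar R,
      [/\ forall n, stopping_time F (tau n),
          {ae P, forall w, {homo tau ^~ w : m n / (m <= n)%N >-> (m <= n)%E}},
          {ae P, forall w, tau ^~ w @ \oo --> +oo%E}
        & forall n, martingale F
            (fun s w => stopped X (tau n) s w - X 0 w)]].

(* [X, Y]_s = \int_0^s a_u du, for continuous local martingales X and Y
   null at 0. *)
Definition bracket_density F X Y (a : R -> T -> R) : Prop :=
  continuous_local_martingale F (fun s w =>
    X s w * Y s w - \int[lebesgue_measure]_(u in `[0, s]) a u w).

End ContinuousLocalMartingales.

Section RDiffusion.
Context d (T : measurableType d) (R : realType) (P : probability T R).
Implicit Types (c rho : R) (xi v : 'rV[R]_4).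

(* 6c(2c-1)/t^2 is minus the scalar curvature, so that the coefficients below
   are (3/2) Xi v^k and Xi (v^k v^l - g^kl) with Xi = - rho^2 R: these are the
   Ito coefficients of the vertical part (1/2) div (Xi grad) of the generator,
   in the ambient coordinates of the hyperboloid. *)
Definition R_drift c rho (k : 'I_4) xi v : R :=
  9 * c * (2 * c - 1) * rho ^+ 2 / time xi ^+ 2 * v 0 k
  - \sum_(i < 4) \sum_(j < 4)
      christoffel (eds_metric c) k i j xi * v 0 i * v 0 j.

Definition R_covariance c (k l : 'I_4) xi v : R :=
  6 * c * (2 * c - 1) * (v 0 k * v 0 l - invmx (eds_metric c xi) k l)
  / time xi ^+ 2.

(* (X, V) is an R-diffusion with parameter rho started from p0: a (weak)
   solution, on some filtered probability space, of dX = V ds and of the Ito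
   equation dV^k = rho dM^k + R_drift^k ds with
   d[M^k, M^l] = R_covariance^kl ds. *)
Definition R_diffusion c rho (F : R -> set (set T)) (p0 : 'rV[R]_4 * 'rV[R]_4)
    (X V : R -> T -> 'rV[R]_4) : Prop :=
  filtration F /\
  (forall s w, 0 <= s -> eds_unit_tangent c (X s w, V s w)) /\
  continuous_paths X /\ continuous_paths V /\
  (forall k, adapted F (fun s w => X s w 0 k)) /\
  (forall k, adapted F (fun s w => V s w 0 k)) /\
  {ae P, forall w, (X 0 w, V 0 w) = p0} /\
  {ae P, forall w, forall s, 0 <= s -> forall k,
     X s w 0 k = X 0 w 0 k + \int[lebesgue_measure]_(u in `[0, s]) V u w 0 k} /\
  exists M : 'I_4 -> R -> T -> R,
    [/\ forall k w, M k 0 w = 0,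
        forall k, continuous_local_martingale P F (M k),
        forall k l, bracket_density P F (M k) (M l)
          (fun u w => R_covariance c k l (X u w) (V u w))
      & {ae P, forall w, forall s, 0 <= s -> forall k,
          V s w 0 k = V 0 w 0 k + rho * M k s w
            + \int[lebesgue_measure]_(u in `[0, s])
                R_drift c rho k (X u w) (V u w)}].

End RDiffusion.

Section ClosedForms.
Variable R : realType.
Implicit Types (c : R) (xi v : 'rV[R]_4) (i j k : 'I_4).

Lemma partial_time (f : R -> R) i xi :
  partial i (fun y => f (time y)) xi =
  if i == ord0 then 'D_1 f (time xi) else 0.
Proof.
rewrite /partial /derive.
rewrite (_ : (fun h => _) = (fun h : R =>
  h^-1 *: (f (h * (i == ord0)%:R + time xi) - f (time xi)))); last first.
  by apply/funext => h; rewrite /time /= !mxE /= eq_sym.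
case: ifP => _.
  rewrite (_ : (fun h => _) = (fun h : R =>
    h^-1 *: (f (h *: 1 + time xi) - f (time xi)))) //.
rewrite (_ : (fun h => _) = cst 0); last first.
  by apply/funext => h; rewrite mulr0 add0r subrr scaler0.
exact: lim_cst.
Qed.

Lemma near_partial (f g : 'rV[R]_4 -> R) i xi : 0 < time xi ->
  (forall y, 0 < time y -> f y = g y) -> partial i f xi = partial i g xi.
Proof.
move=> t0 fg; rewrite /partial; apply: near_eq_derive.
have pos : \forall y \near xi, 0 < time y.
  exact: (@coord_continuous R 1 4 0 ord0 xi) (lt_nbhsr t0).
by apply: filterS pos => y; exact: fg.
Qed.

Lemma invmx_eds_metric c xi : 0 < time xi ->
  invmx (eds_metric c xi) =
  diag_mx (\row_i (if i == ord0 then 1 else - (time xi `^ (2 * c))^-1)).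
Proof.
move=> t0; have p0 : time xi `^ (2 * c) != 0 by rewrite gt_eqF// powR_gt0.
set D := diag_mx _.
have DM : D *m eds_metric c xi = 1%:M.
  rewrite /D /eds_metric mulmx_diag -[RHS]diag_const_mx; congr diag_mx.
  apply/matrixP => a i; rewrite !mxE; case: ifP => _; first by rewrite mulr1.
  by rewrite mulrNN mulVf.
by rewrite -[RHS]mulmx1 -(mulmxV (proj2 (mulmx1_unit DM))) mulmxA DM mul1mx.
Qed.

Definition eds_gamma c k i j (t : R) : R :=
  if k == ord0 then
    if (i != ord0) && (i == j) then c * t `^ (2 * c - 1) else 0
  else if ((i == ord0) && (j == k)) || ((j == ord0) && (i == k)) then c * t^-1
  else 0.

Lemma christoffel_eds c k i j xi : 0 < time xi ->
  christoffel (eds_metric c) k i j xi = eds_gamma c k i j (time xi).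
Proof.
move=> t0; rewrite /christoffel invmx_eds_metric//.
have dg a b l : partial l (fun y => eds_metric c y a b) xi =
    if (l == ord0) && (a == b) && (a != ord0) then
      - (2 * c * time xi `^ (2 * c - 1)) else 0.
  pose h (t : R) := (if a == ord0 then 1 else - t `^ (2 * c)) *+ (a == b).
  rewrite (_ : (fun y => _) = (fun y => h (time y))); last first.
    by apply/funext => y; rewrite /h !mxE; case: eqVneq => [->|].
  rewrite partial_time; case: (l == ord0) => //=.
  rewrite /h; case: (a == b) => /=; last by rewrite derive_cst.
  case: (a == ord0) => /=; first by rewrite derive_cst.
  have h0 : is_derive (time xi) 1 (@powR R ^~ (2 * c))
    (2 * c * time xi `^ (2 * c - 1)) by exact: is_derive1_powR.
  by rewrite (_ : (fun _ => _) = - (fun t : R => t `^ (2 * c) : R))// deriveN ?derive_val.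
rewrite (bigD1 k)//= big1 ?addr0; last first.
  by move=> l lk; rewrite !mxE [k == l]eq_sym (negPf lk) mulr0n mul0r.
rewrite !dg !mxE eqxx mulr1n /eds_gamma.
have p0 : time xi `^ (2 * c) != 0 by rewrite gt_eqF// powR_gt0.
have tn0 : time xi != 0 by rewrite gt_eqF.
have tp : time xi `^ (2 * c - 1) = time xi `^ (2 * c) / time xi.
  by rewrite powRD ?tn0 ?implybT// powR_inv1// ltW.
rewrite tp; set p := _ `^ _ in p0 *; set t := time xi in tn0 *.
case: i => [[|[|[|[|//]]]] hi]; case: j => [[|[|[|[|//]]]] hj];
  case: k => [[|[|[|[|//]]]] hk]; rewrite -!val_eqE /=;
  field; rewrite ?p0 ?tn0 //.
Qed.

Lemma partial_christoffel_eds c k i j l xi : 0 < time xi ->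
  partial l (christoffel (eds_metric c) k i j) xi =
  if l == ord0 then
    if k == ord0 then
      if (i != ord0) && (i == j) then
        c * (2 * c - 1) * time xi `^ (2 * c) / time xi ^+ 2 else 0
    else if ((i == ord0) && (j == k)) || ((j == ord0) && (i == k)) then
      - c / time xi ^+ 2
    else 0
  else 0.
Proof.
move=> t0; have tn0 : time xi != 0 by rewrite gt_eqF.
rewrite (near_partial (g := fun y => eds_gamma c k i j (time y)))//; last first.
  by move=> y y0; rewrite christoffel_eds.
rewrite partial_time; case: ifP => // _; rewrite /eds_gamma.
case: ifP => _; case: ifP => _; rewrite ?derive_cst//.
- have h : is_derive (time xi) 1 (@powR R ^~ (2 * c - 1))
      ((2 * c - 1) * time xi `^ (2 * c - 1 - 1)) by exact: is_derive1_powR.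
  rewrite (_ : (fun t => _) = c *: (fun t : R => t `^ (2 * c - 1) : R))//.
  rewrite deriveZ; last by exact: ex_derive.
  rewrite derive_val.
  rewrite powRD ?tn0 ?implybT// powRD ?tn0 ?implybT// powR_inv1 ?ltW//.
  by rewrite /GRing.scale/=; field.
- rewrite (_ : (fun t => _) = c *: (fun t : R => t^-1 : R))//.
  rewrite deriveZ; last exact: derivableV.
  rewrite deriveV// derive_id /GRing.scale/=.
  by field.
Qed.

Lemma ricci_eds c i j xi : 0 < time xi ->
  ricci (eds_metric c) i j xi =
  if i == j then
    if i == ord0 then - 3 * c * (c - 1) / time xi ^+ 2
    else c * (3 * c - 1) * time xi `^ (2 * c) / time xi ^+ 2
  else 0.
Proof.
move=> t0; have tn0 : time xi != 0 by rewrite gt_eqF.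
have tp : time xi `^ (2 * c - 1) = time xi `^ (2 * c) / time xi.
  by rewrite powRD ?tn0 ?implybT// powR_inv1// ltW.
rewrite /ricci.
under eq_bigr do rewrite !partial_christoffel_eds//.
under [X in _ + X]eq_bigr do under eq_bigr do rewrite !christoffel_eds//.
rewrite /eds_gamma tp; set p := _ `^ _; set t := time xi in tn0 *.
rewrite !big_ord_recl !big_ord0 /=.
case: i => [[|[|[|[|//]]]] hi]; case: j => [[|[|[|[|//]]]] hj];
 rewrite -!val_eqE /=; field; exact: tn0.
Qed.

Lemma scalar_curvature_eds c xi : 0 < time xi ->
  scalar_curvature (eds_metric c) xi = - 6 * c * (2 * c - 1) / time xi ^+ 2.
Proof.
move=> t0; have tn0 : time xi != 0 by rewrite gt_eqF.
have p0 : time xi `^ (2 * c) != 0 by rewrite gt_eqF// powR_gt0.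
rewrite /scalar_curvature.
under eq_bigr do under eq_bigr do rewrite ricci_eds// invmx_eds_metric// !mxE.
rewrite !big_ord_recl !big_ord0 -!val_eqE /=; field.
by rewrite p0 tn0.
Qed.

Lemma energy_eds c xi v : eds_unit_tangent c (xi, v) ->
  energy (eds_metric c) xi v =
  c / time xi ^+ 2 * (2 * v 0 ord0 ^+ 2 + 3 * c - 2).
Proof.
case=> /= t0 ht _; have tn0 : time xi != 0 by rewrite gt_eqF.
have p0 : time xi `^ (2 * c) != 0 by rewrite gt_eqF// powR_gt0.
have E : \sum_(i < 4 | i != ord0) v 0 i ^+ 2 =
    (v 0 ord0 ^+ 2 - 1) / time xi `^ (2 * c).
  apply: (mulIf p0); rewrite divfK// mulrC -[X in _ - X]ht.
  by rewrite opprB addrCA subrr addr0.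
rewrite /energy scalar_curvature_eds//.
rewrite (bigD1 ord0)//= [X in X + _ - _](bigD1 ord0)//= big1 ?addr0; last first.
  by move=> j j0; rewrite ricci_eds// eq_sym (negPf j0) !mul0r.
rewrite (eq_bigr (fun i : 'I_4 =>
    c * (3 * c - 1) * time xi `^ (2 * c) / time xi ^+ 2 * v 0 i ^+ 2)).
  by rewrite -mulr_sumr E ricci_eds// !eqxx; field; rewrite p0 tn0.
move=> i i0; rewrite (bigD1 i)//= big1 ?addr0.
  by rewrite ricci_eds// eqxx (negPf i0); ring.
by move=> j ji; rewrite ricci_eds// eq_sym (negPf ji) !mul0r.
Qed.

End ClosedForms.

(* Main.v *)
Require Import Defs.
From HB Require Import structures.
From mathcomp Require Import all_boot all_order all_algebra.
From mathcomp Require Import ring lra.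
From mathcomp Require Import all_classical all_reals all_analysis.
From mathcomp Require Import measurable_realfun.

Set Implicit Arguments.
Unset Strict Implicit.
Unset Printing Implicit Defensive.

Import Order.TTheory GRing.Theory Num.Theory.
Import numFieldNormedType.Exports.

Local Open Scope classical_set_scope.
Local Open Scope ring_scope.

(** Write t for the time coordinate, a for its derivative with respect to
    proper time, and q = 9 c (2c - 1) rho^2.  On the hyperboloid the equation
    of the time component of the velocity is
    [da = rho dM + q a / t^2 ds - (c / t) (a^2 - 1) ds].
    As [a ds = dt], the first drift term is exact: its integral is
    [q (1 / t_0 - 1 / t_s)], which lies between 0 and [q / t_0].  Writing [I]
    for the nondecreasing integral of the friction term [(c / t) (a^2 - 1)],
    we get the pathwise balance
    [a_s + I_s = a_0 + rho M_s + q (1 / t_0 - 1 / t_s)].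
    The left-hand side is nonnegative, so the continuous local martingale M is
    bounded below by a deterministic constant.  It therefore converges almost
    surely to a finite limit, and everything else is deterministic: [I] is
    monotone and bounded, hence convergent, so [a] converges; since [t] grows
    at most linearly once [a] is bounded, a limit larger than 1 would make [I]
    increase by a fixed amount on each interval [s, 2s].  Hence [a] tends to 1
    ([velocity_cvg1]), and since [t_s >= t_0 + s] the energy, which is
    [c (2 a^2 + 3c - 2) / t^2], tends to 0.

    The probabilistic ingredient is the convergence of continuous local
    martingales that are bounded below.  Fatou's lemma along the localizing
    times turns such a process, shifted by a constant, into a nonnegative
    supermartingale ([bounded_below_local_martingale]).  Doob's upcrossing
    inequality on finite grids ([upcrossing_inequality]), followed by a
    refinement of the grids, forbids oscillation across a rational interval,
    and Fatou's lemma forbids divergence to infinity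
    ([nonneg_supermartingale_cvg]). *)

(** * Consequences of Fatou's lemma *)

Lemma measurable_fun_limn_einf d (T : measurableType d) (R : realType)
    (D : set T) (f : (T -> \bar R)^nat) :
  (forall n, measurable_fun D (f n)) ->
  measurable_fun D (fun x => limn_einf (f ^~ x)).
Proof.
move=> mf; rewrite (_ : (fun x => _) =
  \- (fun x => limn_esup (fun n => - f n x)%E))%E.
  apply: measurableT_comp => //; apply: measurable_fun_limn_esup => n.
  exact: measurableT_comp.
by apply/funext.
Qed.

Section Fatou.
Context d (T : measurableType d) (R : realType).
Variable mu : {measure set T -> \bar R}.

Lemma limn_einf_le_cst (u : (\bar R)^nat) (C : \bar R) :
  (forall n, u n <= C)%E -> (limn_einf u <= C)%E.
Proof.
move=> uC; rewrite limn_einf_lim; apply: lime_le; first exact: is_cvg_einfs.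
apply: nearW => n; apply: le_trans (uC n).
by apply: ereal_inf_lbound => /=; exists n => /=.
Qed.

(** Fatou's lemma when the limit inferior is known to be a limit almost
    everywhere, so that the limit function can be chosen freely on the
    exceptional set. *)
Lemma ae_cvg_le_integral (f : nat -> T -> R) (g : T -> R) (C : \bar R) :
  (forall n, measurable_fun setT (f n)) -> measurable_fun setT g ->
  (forall n x, 0 <= f n x) -> (forall x, 0 <= g x) ->
  {ae mu, forall x, f ^~ x @ \oo --> g x} ->
  (forall n, \int[mu]_x (f n x)%:E <= C)%E -> (\int[mu]_x (g x)%:E <= C)%E.
Proof.
move=> mf mg f0 g0 fg fC.
apply: le_trans (limn_einf_le_cst fC).
apply: le_trans (@fatou _ _ _ mu _ measurableT (fun n x => (f n x)%:E) _ _);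
  last 2 first.
- by move=> n; exact/measurable_EFinP.
- by move=> n x _; rewrite lee_fin.
apply: ae_ge0_le_integral => //.
- by move=> x _; rewrite lee_fin.
- exact/measurable_EFinP.
- move=> x _; rewrite limn_einf_lim; apply: lime_ge; first exact: is_cvg_einfs.
  by apply: nearW => n; apply: le_ereal_inf_tmp => _ [m _ <-]; rewrite lee_fin.
- by apply: measurable_fun_limn_einf => n; exact/measurable_EFinP.
apply: filterS fg => x fgx _.
have /cvg_limn_einf_sup[-> _] // : (EFin \o (f ^~ x)) @ \oo --> (g x)%:E.
exact: (cvg_comp _ _ fgx).
Qed.

(** The limit inferior has integral at most [C] by Fatou's lemma, so it is
    finite almost everywhere. *)
Lemma ae_not_cvg_pinfty (f : nat -> T -> R) (C : R) :
  (forall n, measurable_fun setT (f n)) -> (forall n x, 0 <= f n x) ->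
  (forall n, \int[mu]_x (f n x)%:E <= C%:E)%E ->
  {ae mu, forall x, ~ (f ^~ x @ \oo --> +oo)}.
Proof.
move=> mf f0 fC.
pose L x := limn_einf (fun n => (f n x)%:E).
have L0 x : (0 <= L x)%E.
  rewrite /L limn_einf_lim; apply: lime_ge; first exact: is_cvg_einfs.
  by apply: nearW => n; apply: le_ereal_inf_tmp => _ [m _ <-]; rewrite lee_fin.
have mL : measurable_fun setT L.
  by apply: measurable_fun_limn_einf => n; exact/measurable_EFinP.
have iL : mu.-integrable setT L.
  apply/integrableP; split => //.
  under eq_integral do rewrite gee0_abs//.
  apply: (@le_lt_trans _ _ C%:E); last exact: ltry.
  apply: le_trans (limn_einf_le_cst fC).
  apply: fatou => //; first by move=> n; exact/measurable_EFinP.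
  by move=> n x _; rewrite lee_fin.
have := integrable_ae measurableT iL.
apply: filterS => x /(_ I) + /cvgeryP fy.
by rewrite /L; have [-> _] := cvg_limn_einf_sup fy.
Qed.

End Fatou.

(** * Local martingales bounded below *)

Section Supermartingale.
Context d (T : measurableType d) (R : realType) (P : probability T R).
Implicit Types (F : R -> set (set T)) (M Y : R -> T -> R).

(** The inequality is between integrals in [[0, +oo]] over the events of the
    past, which makes sense before integrability is known and avoids
    conditional expectations. *)
Definition nonneg_supermartingale F Y : Prop :=
  [/\ adapted F Y, forall s w, 0 <= Y s w,
      (\int[P]_w (Y 0 w)%:E < +oo)%E
    & forall s u A, 0 <= s -> s <= u -> F s A ->
        (\int[P]_(w in A) (Y u w)%:E <= \int[P]_(w in A) (Y s w)%:E)%E].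

Lemma adapted_measurable F Y s : filtration F -> adapted F Y -> 0 <= s ->
  measurable_fun setT (Y s).
Proof.
by move=> [_ Fm _] aY s0 _ B mB; rewrite setTI; apply: (Fm s) => //; exact: aY.
Qed.

Lemma stopped_eq M (tau : T -> \bar R) s w : (s%:E <= tau w)%E ->
  stopped M tau s w = M s w.
Proof. by move=> st; rewrite /stopped min_l. Qed.

Lemma filtrationI F s A B : filtration F -> 0 <= s -> F s A -> F s B ->
  F s (A `&` B).
Proof.
move=> [Fs _ _] s0 FA FB; have sF := Fs _ s0.
rewrite -(sigma_algebra_id sF); 
apply: (@measurableI _ (g_sigma_algebraType (F s)) A B);
  exact: sub_sigma_algebra.
Qed.

Lemma filtrationC F s A : filtration F -> 0 <= s -> F s A -> F s (~` A).
Proof.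
by move=> [Fs _ _] s0 FA; rewrite -setTD; case: (Fs _ s0) => _ + _; exact.
Qed.

Lemma filtrationU F s A B : filtration F -> 0 <= s -> F s A -> F s B ->
  F s (A `|` B).
Proof.
move=> hF s0 FA FB; rewrite -[_ `|` _]setCK setCU.
by apply: filtrationC => //; apply: filtrationI => //; exact: filtrationC.
Qed.

(** The absolute value makes the process nonnegative everywhere; it only
    differs from [M + C] on the negligible set where the bound fails.
    For an event A of the past of s, the martingale property is used on the
    part of A where the n-th localizing time exceeds s: there the process
    stopped at that time takes at s the value of M, and this part belongs to
    the past of s.  Fatou's lemma then lets n tend to infinity. *)
Lemma bounded_below_local_martingale F M (C : R) : filtration F ->
  continuous_local_martingale P F M -> (forall w, M 0 w = 0) ->
  {ae P, forall w, forall s, 0 <= s -> - C <= M s w} ->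
  nonneg_supermartingale F (fun s w => `|M s w + C|).
Proof.
move=> hF [aM cM [tau [st _ tauy mart]]] M0 MC.
have aY : adapted F (fun s w => `|M s w + C|).
  move=> s s0 B mB; apply: (aM s s0 [set x | B `|x + C|]).
  rewrite -[X in measurable X]setTI.
  suff mf : measurable_fun setT (fun x : R => `|x + C|) by exact: mf.
  by apply: measurableT_comp => //; exact: measurable_funD.
split => //.
- under eq_integral do rewrite M0.
  by rewrite integral_cst//= probability_setT mule1 ltry.
- move=> s u A s0 su FA; have u0 := le_trans s0 su.
have mFs B : F s B -> measurable B by case: hF => _ Fm _; exact: Fm.
(* [Z n] is the shifted process stopped at the n-th localizing time, and [B n]
   the part of A where this time has not been reached at s. *)
pose Z n v w := `|stopped M (tau n) v w + C|.
pose B n := A `&` ~` [set w | tau n w <= s%:E]%E.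
have FB n : F s (B n).
  apply: filtrationI => //; apply: filtrationC => //.
  by have [_] := st n; exact.
have mB n : measurable (B n) by exact: mFs.
have mS n v : 0 <= v -> measurable_fun setT (stopped M (tau n) v).
  move=> v0; have [aS _ _] := mart n.
  have := adapted_measurable hF aS v0.
  by under eq_fun do rewrite M0 subr0.
have mZ n v : 0 <= v -> measurable_fun setT (Z n v).
  move=> v0; apply: measurableT_comp => //; apply: measurable_funD => //.
  exact: mS.
have mY v : 0 <= v -> measurable_fun setT (fun w => `|M v w + C|).
  by move=> v0; exact: (adapted_measurable hF aY v0).
have intZ n v : s <= v ->
    (\int[P]_(w in B n) (Z n v w)%:E =
     \int[P]_(w in B n) (stopped M (tau n) s w)%:E + C%:E * P (B n))%E.
  move=> sv; have v0 := le_trans s0 sv.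
  have [_ iS eS] := mart n.
  have iM : P.-integrable (B n) (EFin \o stopped M (tau n) v).
    apply: (integrableS measurableT) => //.
    by have := iS v v0; under eq_fun do rewrite /= M0 subr0.
  have -> : (\int[P]_(w in B n) (Z n v w)%:E =
      \int[P]_(w in B n) ((stopped M (tau n) v w)%:E + C%:E))%E.
    apply: ae_eq_integral => //.
    - by apply/measurable_EFinP; apply: measurable_funTS; exact: mZ.
    - apply/measurable_EFinP; apply: measurable_funTS.
      by apply: measurable_funD => //; exact: mS.
    - apply: filterS MC => w MCw _ /=.
      rewrite /Z ger0_norm ?EFinD// -lerBlDr sub0r.
      apply: MCw; apply: fine_ge0; rewrite le_min lee_fin v0/=.
      by have [+ _] := st n; exact.
  rewrite integralD//; last first.
    by apply/finite_measure_integrable_cst.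
  rewrite integral_cst//; congr (_ + _)%E.
  have := eS s v s0 sv (B n) (FB n).
  have -> : (fun w => (stopped M (tau n) v w - M 0 w)%:E) =
    (fun w => (stopped M (tau n) v w)%:E)
    by apply/funext => w; rewrite M0 subr0.
  have -> // : (fun w => (stopped M (tau n) s w - M 0 w)%:E) =
    (fun w => (stopped M (tau n) s w)%:E)
    by apply/funext => w; rewrite M0 subr0.
(* The same n is used for the stopping time and for the event, so that one
   application of Fatou's lemma is enough. *)
pose f n := Z n u \_ (B n).
pose g := (fun w => `|M u w + C|) \_ A.
have -> : (\int[P]_(w in A) (`|M u w + C|)%:E = \int[P]_w (g w)%:E)%E.
  rewrite integral_mkcond; apply: eq_integral => w _.
  by rewrite /g restrict_EFin.
apply: (@ae_cvg_le_integral _ _ _ P f g).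
- move=> n; apply/(measurable_restrictT _ (mB n)).
  by apply: measurable_funTS; exact: mZ.
- apply/(measurable_restrictT _ (mFs _ FA)).
  by apply: measurable_funTS; exact: mY.
- by move=> n w; rewrite /f /Z patchE; case: ifP.
- by move=> w; rewrite /g patchE; case: ifP.
- apply: filterS tauy => w tw; apply: cvg_near_cst.
  have /cvgeyPgt/(_ u) := tw; apply: filterS => n ut.
  rewrite /f /g !patchE /Z stopped_eq ?ltW//.
  suff -> : (w \in B n) = (w \in A) by [].
  apply/idP/idP; rewrite !inE; first by case.
  move=> Aw; split => //=; apply/negP; rewrite -ltNge.
  by apply: le_lt_trans ut; rewrite lee_fin.
move=> n; have -> : (\int[P]_w (f n w)%:E = \int[P]_(w in B n) (Z n u w)%:E)%E.
  rewrite [RHS]integral_mkcond; apply: eq_integral => w _.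
  by rewrite /f restrict_EFin.
rewrite intZ// -(intZ n s)//.
have -> : (\int[P]_(w in B n) (Z n s w)%:E =
    \int[P]_(w in B n) `|M s w + C|%:E)%E.
  apply: eq_integral => w; rewrite inE => -[_ /=] /negP.
  rewrite -ltNge => /ltW sw.
  by rewrite /Z stopped_eq.
apply: ge0_subset_integral => //.
- exact: mFs.
- by apply/measurable_EFinP; apply: measurable_funTS; exact: mY.
- by move=> w [].
Qed.

End Supermartingale.

(** * Doob's upcrossing inequality *)

Section UpcrossingCount.
Variables (R : realType) (a b : R).
Implicit Types (y : nat -> R) (n : nat).

(** The state after step n of the strategy that buys one share as soon as the
    price is below [a] and sells it as soon as the price exceeds [b]. *)
Fixpoint holding y n : bool :=
  if n is m.+1 then (y m.+1 < a) || (holding y m && (y m.+1 <= b))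
  else y 0%N < a.

Fixpoint upcrossings y n : nat :=
  if n is m.+1 then (upcrossings y m + (holding y m && (b < y m.+1)%R))%N
  else 0%N.

Definition gain y n : R := \sum_(i < n) (holding y i)%:R * (y i.+1 - y i).

(** Each completed upcrossing earns at least [b - a]; the second term is the
    value of the share bought below [a] that may still be held. *)
Lemma upcrossings_gain y n : a < b ->
  (b - a) * (upcrossings y n)%:R + (holding y n)%:R * (y n - a) <= gain y n.
Proof.
move=> ab; elim: n => [|n IH].
  rewrite /gain big_ord0 /= mulr0 add0r.
  by case: ltP => ya; rewrite ?mul0r// mul1r subr_le0 ltW.
rewrite /gain big_ord_recr -/(gain y n) /=.
move: IH; case: (holding y n) => /=; rewrite ?mul1r ?mul0r ?addn0 ?addr0;
  case: (ltP (y n.+1) a) => ya; case: (leP (y n.+1) b) => yb /=;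
  rewrite ?mul1r ?mul0r ?addn0 ?addr0 ?addn1 => IH;
  rewrite -?natr1; lra.
Qed.

Lemma upcrossings_le_gain y n : 0 <= a -> a < b -> (forall i, 0 <= y i) ->
  (b - a) * (upcrossings y n)%:R <= gain y n + a.
Proof.
move=> a0 ab y0; have := upcrossings_gain y n ab.
have := y0 n; case: (holding y n); rewrite ?mul1r ?mul0r; lra.
Qed.

Lemma upcrossings_homo y m n : (m <= n)%N ->
  (upcrossings y m <= upcrossings y n)%N.
Proof.
move=> /subnKC <-; elim: (n - m)%N => [|k IH]; first by rewrite addn0.
by rewrite addnS /= (leq_trans IH)// leq_addr.
Qed.

(** The number of upcrossings plus the state of the strategy never decreases;
    it counts an upcrossing from the moment of the purchase. *)
Lemma upcrossings_lt y m n : a < b -> (m <= n)%N -> y m < a -> b < y n ->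
  (upcrossings y m < upcrossings y n)%N.
Proof.
move=> ab mn ym yn.
have Hm : holding y m by case: (m) ym => [|k] /= ->.
have nHn : ~~ holding y n.
  case: (n) yn => [|k] /= yk; first by rewrite -leNgt ltW// (lt_trans ab).
  by rewrite negb_or -leNgt (ltW (lt_trans ab yk)) leNgt yk andbF.
suff : (upcrossings y m + 1 <= upcrossings y n + holding y n)%N.
  by rewrite (negPf nHn) addn0 addn1.
rewrite -(subnKC mn); elim: (n - m)%N => [|k IH]; first by rewrite addn0 Hm.
rewrite [(m + _)%N]addnS /= (leq_trans IH)// -addnA leq_add2l.
by case: (holding y _) => //=; case: leP => //= _; rewrite orbT.
Qed.

End UpcrossingCount.

Section UpcrossingInequality.
Context d (T : measurableType d) (R : realType) (P : probability T R).
Variables (F : R -> set (set T)) (Y : R -> T -> R).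
Hypotheses (hF : filtration F) (hY : nonneg_supermartingale P F Y).

Lemma supermartingale_integrable s : 0 <= s -> P.-integrable setT (EFin \o Y s).
Proof.
have [aY Y0 Y0y EY] := hY; move=> s0; apply/integrableP; split.
  by apply/measurable_EFinP; exact: (adapted_measurable hF aY).
under eq_integral do rewrite gee0_abs ?lee_fin//.
apply: le_lt_trans Y0y; apply: EY => //.
have [F0 _ _] := hF; have [FF0 + _] := F0 0 (lexx _).
by move=> /(_ _ FF0); rewrite setD0.
Qed.

Variables (a b : R) (t : nat -> R).
Hypotheses (a0 : 0 <= a) (ab : a < b) (t0 : 0 <= t 0%N)
  (tn : {homo t : m n / (m <= n)%N >-> m <= n}).

Let y w n := Y (t n) w.
Let t_ge0 n : 0 <= t n. Proof. by rewrite (le_trans t0)// tn. Qed.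

(** The strategy is predictable: the decision taken at step n depends only on
    the past of [t n]. *)
Lemma holding_mem n : F (t n) [set w | holding a b (y w) n].
Proof.
have [aY _ _ _] := hY.
have Flt n' : F (t n') [set w | y w n' < a].
  have := aY _ (t_ge0 n') _ (measurable_itv `]-oo, a[).
  by congr (F _ _); apply/seteqP; split => w /=; rewrite in_itv.
elim: n => [|n IH] /=; first exact: Flt.
have -> : [set w | (y w n.+1 < a) || holding a b (y w) n && (y w n.+1 <= b)] =
    [set w | y w n.+1 < a] `|`
    ([set w | holding a b (y w) n] `&` (Y (t n.+1) @^-1` `]-oo, b])).
  apply/seteqP; split => w /=; rewrite in_itv/=.
    by move=> /orP[|/andP]; tauto.
  by case=> [->//|[-> ->]]; rewrite orbT.
apply: filtrationU => //; apply: filtrationI => //.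
  by have [_ _ +] := hF; apply; last exact: IH; rewrite ?tn.
exact: aY.
Qed.

Let mholding n : measurable [set w | holding a b (y w) n].
Proof. by have [_ Fm _] := hF; exact: (Fm _ (t_ge0 n) _ (holding_mem n)). Qed.

Let mY n : measurable_fun setT (Y (t n)).
Proof. by have [aY _ _ _] := hY; exact: (adapted_measurable hF aY). Qed.

Lemma measurable_upcrossings n :
  measurable_fun setT (fun w => (upcrossings a b (y w) n)%:R : R).
Proof.
elim: n => [|n IH] /=; first exact: measurable_cst.
pose S := [set w | holding a b (y w) n] `&` (Y (t n.+1) @^-1` `]b, +oo[).
have mS : measurable S.
  by apply: measurableI => //; rewrite -[X in measurable X]setTI; exact: mY.
rewrite (_ : (fun w => _) =
    (fun w => (upcrossings a b (y w) n)%:R : R) \+ \1_S); last first.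
  apply/funext => w /=; rewrite natrD indicE; congr (_ + _%:R).
  congr nat_of_bool; apply/idP/idP; rewrite inE /S /= in_itv/= andbT.
    by move=> /andP.
  by case=> -> ->.
by apply: measurable_funD => //; exact: measurable_indic.
Qed.

(** Each increment of the process is integrated over an event of the past,
    where its expectation is nonpositive. *)
Lemma gain_integral_le0 n :
  P.-integrable setT (fun w => (gain a b (y w) n)%:E) /\
  (\int[P]_w (gain a b (y w) n)%:E <= 0)%E.
Proof.
have [aY Y0 _ EY] := hY.
elim: n => [|n [IHi IHn]].
  have -> : (fun w => (gain a b (y w) 0)%:E) = cst 0%E.
    by apply/funext => w; rewrite /gain big_ord0.
  by split; [exact: integrable0|rewrite integral0].
set A := [set w | holding a b (y w) n].
have mA : measurable A by exact: mholding.
pose D w := (Y (t n.+1) w - Y (t n) w)%:E.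
have iY m : P.-integrable A (EFin \o Y (t m)).
  by apply: (integrableS measurableT) => //; exact: supermartingale_integrable.
have iD : P.-integrable A D := integrableB mA (iY n.+1) (iY n).
have gS : (fun w => (gain a b (y w) n.+1)%:E) =
    (fun w => (gain a b (y w) n)%:E) \+ (D \_ A).
  apply/funext => w; rewrite /gain big_ord_recr/= EFinD; congr (_ + _)%E.
  rewrite patchE; case: ifPn => [/set_mem /= ->|]; first by rewrite mul1r.
  by rewrite notin_setE /A /= => /negP/negPf ->; rewrite mul0r.
have iDA : P.-integrable setT (D \_ A) by apply/(integrable_mkcond _ mA).
rewrite gS; split; first exact: (integrableD measurableT IHi iDA).
rewrite integralD// -[leRHS]adde0; apply: leeD => //.
rewrite -integral_mkcond /D.
under eq_integral do rewrite EFinB.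
rewrite (integralB mA (iY _) (iY _)) sube_le0.
by apply: EY => //; [exact: tn|exact: holding_mem].
Qed.

(** The bound depends neither on the number of steps nor on the times, and so
    survives the refinement of the grids. *)
Lemma upcrossing_inequality n :
  (\int[P]_w ((upcrossings a b (y w) n)%:R)%:E <= (a / (b - a))%:E)%E.
Proof.
have [iG G0] := gain_integral_le0 n.
have ba : 0 < b - a by rewrite subr_gt0.
have y0 w i : 0 <= y w i by have [_ Y0 _ _] := hY; exact: Y0.
rewrite -(@lee_pmul2l _ (b - a)%:E) ?lte_fin//.
rewrite -ge0_integralZl//; last 2 first.
- by apply/measurable_EFinP; exact: measurable_upcrossings.
- by rewrite lee_fin ltW.
rewrite -EFinM mulrC divfK ?gt_eqF//.
apply: (@le_trans _ _ (\int[P]_w ((gain a b (y w) n)%:E + a%:E))%E).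
  apply: ge0_le_integral => //.
  - by move=> w _; rewrite lee_fin mulr_ge0// ltW.
  - apply/measurable_EFinP; apply: measurable_funM => //.
    exact: measurable_upcrossings.
  - apply: emeasurable_funD => //; exact: (measurable_int P).
  - by move=> w _; rewrite -EFinM -EFinD lee_fin; exact: upcrossings_le_gain.
rewrite integralD//; last exact: finite_measure_integrable_cst.
by rewrite integral_cst//= probability_setT mule1 -[leRHS]add0e leeD.
Qed.

End UpcrossingInequality.

(** * Almost sure convergence of nonnegative supermartingales *)

Section Oscillation.
Variable R : realType.
Implicit Types (f : R -> R) (a b s u : R).

(** The negation of [\forall u \near +oo, ~ Q u]. *)
Definition frequently (Q : R -> Prop) : Prop :=
  forall s, exists2 u, s <= u & Q u.

Lemma frequently_ge0 Q s : frequently Q -> exists u, [/\ 0 <= u, s <= u & Q u].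
Proof.
move=> /(_ (Num.max s 0))[u + Qu]; rewrite ge_max => /andP[su u0].
by exists u.
Qed.

Lemma not_frequently Q : ~ frequently Q -> \forall u \near +oo, ~ Q u.
Proof.
move=> /existsNP[s nQ]; exists s; split; first exact: num_real.
by move=> u su Qu; apply: nQ; exists u => //; exact: ltW.
Qed.

(** The limit is the infimum [L] of the levels below which [f] returns
    frequently.  Above [L], two rationals in the interval from [L] to [L + e]
    are chosen, and the absence of oscillation across them keeps [f] eventually
    below the larger one. *)
Lemma cvg_of_no_oscillation f (B : R) : (forall s, 0 <= f s) ->
  frequently (fun u => f u < B) ->
  (forall p q : rat, 0 <= ratr p :> R -> ratr p < ratr q :> R ->
     ~ (frequently (fun u => f u < ratr p) /\
        frequently (fun u => ratr q < f u))) ->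
  cvg (f @ +oo).
Proof.
move=> f0 fB nosc; pose S := [set x | frequently (fun u => f u < x)].
have S0 : lbound S 0.
  move=> x Sx; have [u _ fu] := Sx 0; exact/ltW/(le_lt_trans (f0 u)).
have infS : has_inf S by split; [exists B|exists 0].
pose L := inf S; have L0 : 0 <= L by apply: lb_le_inf => //; exists B.
apply/cvg_ex; exists L; apply/cvgrPdist_lt => e e0.
have [x Sx xLe] := inf_adherent e0 infS.
have lo : \forall u \near +oo, L - e < f u.
  have nS : ~ S (L - e / 2).
    by move=> /(ge_inf infS.2); rewrite -/L leNgt gtrBl divr_gt0.
  apply: filterS (not_frequently nS) => u /negP; rewrite -leNgt.
  by apply: lt_le_trans; rewrite ltrD2l ltrN2 ltr_pdivrMr// ltr_pMr// ltr1n.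
have xL : L <= x := ge_inf infS.2 Sx.
have [p] := rat_in_itvoo xLe; rewrite in_itv/= => /andP[xp pLe].
have [q] := rat_in_itvoo pLe; rewrite in_itv/= => /andP[pq qLe].
have hi : \forall u \near +oo, f u <= ratr q.
  have : ~ frequently (fun u => ratr q < f u).
    move=> qf; apply: (nosc p q) => //.
      by rewrite (le_trans (le_trans L0 xL))// ltW.
    split => // s; have [u su fu] := Sx s; exists u => //; exact: lt_trans xp.
  by move=> /not_frequently; apply: filterS => u /negP; rewrite -leNgt.
near=> u; rewrite ltr_distlC; apply/andP; split; first by near: u.
by apply: le_lt_trans qLe; near: u.
Unshelve. all: by end_near. Qed.

Definition grid (n i : nat) : R := i%:R / n.+1%:R.

Lemma grid_cvg u : 0 <= u ->
  (fun n => grid n (Num.truncn (u * n.+1%:R))) @ \oo --> u.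
Proof.
move=> u0; apply/cvgrPdist_lt => e e0; near=> n.
have n0 : 0 < n.+1%:R :> R by rewrite ltr0n.
have un0 : 0 <= u * n.+1%:R by rewrite mulr_ge0// ltW.
rewrite /grid -(ltr_pM2r n0) -[X in _ * X < _](gtr0_norm n0) -normrM.
rewrite mulrBl divfK ?gt_eqF//.
have /andP[lo hi] := truncn_itv un0.
rewrite ger0_norm ?subr_ge0// ltrBlDl (lt_le_trans hi)// -natr1 lerD2l.
rewrite -ler_pdivrMl// mulr1 -[leRHS]natr1 ler_wpDr//; near: n.
exact: nbhs_infty_ger.
Unshelve. all: by end_near. Qed.

(** On the grid of step [1 / n.+1], [truncn (u * n.+1)] is the index of the
    last point not after [u]. *)
Lemma grid_near f u (O : set R) : {within `[0, +oo[, continuous f} -> 0 <= u ->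
  open O -> O (f u) ->
  \forall n \near \oo, O (f (grid n (Num.truncn (u * n.+1%:R)))).
Proof.
move=> cf u0 oO Ou.
have fu : f x @[x --> within `[0, +oo[ (nbhs u)] --> f u.
  have hu : [set` `[0, +oo[] u by rewrite /= in_itv/= u0.
  exact: (subspace_continuousP _ _).1 cf u hu.
have : \forall x \near u, x \in `[0, +oo[ -> O (f x).
  exact: (fu O (open_nbhs_nbhs (conj oO Ou))).
move=> nO; have gO : \forall n \near \oo,
    grid n (Num.truncn (u * n.+1%:R)) \in `[0, +oo[ ->
    O (f (grid n (Num.truncn (u * n.+1%:R)))) by exact: (grid_cvg u0 nO).
apply: filterS gO => n; apply.
by rewrite in_itv/= andbT divr_ge0.
Qed.

(** Given times [u <= v] with [f u < a] and [b < f v], the grid points next to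
    them on a fine enough grid have the same property by continuity, and the
    count increases between them; iterating this gives arbitrarily many
    upcrossings before some time independent of the grid.  The n-th grid has
    step [1 / n.+1] and is run for [n.+1 * n.+1] steps, that is up to time
    [n.+1]. *)
Lemma upcrossings_cvgy f a b : {within `[0, +oo[, continuous f} -> a < b ->
  frequently (fun u => f u < a) -> frequently (fun u => b < f u) ->
  ((upcrossings a b (fun i => f (grid n i)) (n.+1 * n.+1))%:R : R)
    @[n --> \oo] --> +oo.
Proof.
move=> cf ab fa fb.
pose U n u :=
  upcrossings a b (fun i => f (grid n i)) (Num.truncn (u * n.+1%:R)).
have UQ k : exists u, \forall n \near \oo, (k <= U n u)%N.
  elim: k => [|k [S IH]]; first by exists 0; exact: nearW.
  have [u [u0 Su fu]] := frequently_ge0 S fa.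
  have [v [v0 uv fv]] := frequently_ge0 u fb.
  have un := grid_near cf u0 (@open_lt R a) fu.
  have vn := grid_near cf v0 (@open_gt R b) fv.
  exists v; near=> n.
  apply: (@leq_ltn_trans (U n u)); last first.
    apply: upcrossings_lt => //.
    - by apply: le_truncn; rewrite ler_pM2r.
    - by near: n.
    - by near: n.
  apply: (@leq_trans (U n S)); first by near: n.
  by apply: upcrossings_homo; apply: le_truncn; rewrite ler_pM2r.
apply/cvgryPge => A.
have [u Uu] := UQ (Num.truncn A).+1; near=> n.
apply: (@le_trans _ _ (Num.truncn A).+1%:R); first exact/ltW/truncnS_gt.
rewrite ler_nat; apply: (@leq_trans (U n u)); first by near: n.
apply: upcrossings_homo; rewrite -(@natrK R (n.+1 * n.+1)) le_truncn//.
rewrite natrM ler_pM2r// -natr1 ler_wpDr//; near: n; exact: nbhs_infty_ger.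
Unshelve. all: by end_near. Qed.

End Oscillation.

Section Convergence.
Context d (T : measurableType d) (R : realType) (P : probability T R).

(** The upcrossing counts on the n-th grids have bounded expectations, so
    outside one negligible set they do not tend to infinity, whatever the pair of
    rationals; the values at integer times have bounded expectations as
    well, which excludes divergence to infinity. *)
Lemma nonneg_supermartingale_cvg (F : R -> set (set T)) (Y : R -> T -> R) :
  filtration F -> nonneg_supermartingale P F Y -> continuous_paths Y ->
  {ae P, forall w, cvg (Y s w @[s --> +oo])}.
Proof.
move=> hF hY cY; have [aY Y0 Y0y EY] := hY.
have YT s : 0 <= s -> (\int[P]_w (Y s w)%:E <= \int[P]_w (Y 0 w)%:E)%E.
  move=> s0; apply: EY => //.
  have [F0 _ _] := hF; have [FF0 + _] := F0 0 (lexx _).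
  by move=> /(_ _ FF0); rewrite setD0.
have bounded : {ae P, forall w, ~ ((fun n => Y n%:R w) @ \oo --> +oo)}.
  apply: (@ae_not_cvg_pinfty _ _ _ P _ (fine (\int[P]_w (Y 0 w)%:E))).
  - by move=> n; exact: (adapted_measurable hF aY).
  - by [].
  - move=> n; rewrite fineK ?YT// ge0_fin_numE//.
    by apply: integral_ge0 => w _; rewrite lee_fin.
(* The pairs of rationals are enumerated by [unpickle], as countable unions of
   negligible sets are indexed by natural numbers. *)
have crossed : {ae P, forall w, forall (k : nat) (p q : rat),
    unpickle k = Some (p, q) -> 0 <= ratr p :> R -> ratr p < ratr q :> R ->
    ~ (((upcrossings (ratr p) (ratr q) (fun i => Y (grid R n i) w)
         (n.+1 * n.+1))%:R : R) @[n --> \oo] --> +oo)}.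
  apply: ae_foralln => k.
  case: (unpickle k) => [[p q]|]; last by apply: nearW.
  have [p0|np] := boolP (0 <= ratr p :> R); last first.
    by apply: nearW => w p' q' [<- _] p0; rewrite p0 in np.
  have [pq|npq] := boolP (ratr p < ratr q :> R); last first.
    by apply: nearW => w p' q' [<- <-] _ pq; rewrite pq in npq.
  have gn n : {homo grid R n : i j / (i <= j)%N >-> i <= j}.
    by move=> i j ij; rewrite /grid ler_pM2r ?invr_gt0// ler_nat.
  have g0 n : 0 <= grid R n 0 by rewrite /grid mul0r.
  apply: filterS (@ae_not_cvg_pinfty _ _ _ P (fun n w =>
    (upcrossings (ratr p) (ratr q) (fun i => Y (grid R n i) w)
         (n.+1 * n.+1))%:R) (ratr p / (ratr q - ratr p)) _ _ _).
  - by move=> w nU p' q' [<- <-].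
  - by move=> n; exact: (measurable_upcrossings hF hY).
  - by move=> n w; exact: ler0n.
  - by move=> n; exact: (upcrossing_inequality hF hY).
apply: filterS2 bounded crossed => w bw cw.
have [B YB] : exists B, frequently (fun u => Y u w < B).
  apply: contrapT => /forallNP YB; apply: bw; apply/cvgryPge => B.
  have [M [_ MB]] := not_frequently (YB B).
  near=> n; rewrite leNgt; apply/negP; apply: MB.
  by near: n; exact: nbhs_infty_gtr.
apply: (cvg_of_no_oscillation _ YB) => // p q p0 pq [fp fq].
apply: (cw (pickle (p, q)) p q) => //; first by rewrite pickleK.
exact: (upcrossings_cvgy (cY w) pq fp fq).
Unshelve. all: by end_near. Qed.

End Convergence.

(** * Long-time behaviour of a single trajectory *)

Section Increments.
Variable R : realType.
Notation mu := (@lebesgue_measure R).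
Implicit Types g : R -> R.

Lemma integrable_within g s : {within `[0, +oo[, continuous g} ->
  mu.-integrable `[0, s] (EFin \o g).
Proof.
move=> cg; apply: continuous_compact_integrable; first exact: segment_compact.
apply: continuous_subspaceW cg => x /=; rewrite !in_itv/= andbT.
by case/andP.
Qed.

Definition primitive g (s : R) : R := \int[mu]_(x in `[0, s]) g x.

Lemma primitive_le0 g s : s <= 0 -> primitive g s = 0.
Proof.
rewrite /primitive le_eqVlt => /predU1P[->|s0].
  by rewrite set_itv1 Rintegral_set1.
by rewrite set_itv_ge ?Rintegral_set0// bnd_simp -ltNge.
Qed.

Lemma primitive_increment g s u : {within `[0, +oo[, continuous g} ->
  0 <= s -> s <= u ->
  primitive g u - primitive g s = \int[mu]_(x in `]s, u]) g x.
Proof.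
move=> cg s0 su; rewrite /primitive Rintegral_itvB//.
exact: integrable_within.
Qed.

Let mu_itv (s u : R) : s <= u -> mu `]s, u] = (u - s)%:E.
Proof.
move=> su; rewrite lebesgue_measure_itv/= lte_fin.
by case: ltgtP su => //= ->; rewrite subrr.
Qed.

Let len (s u k : R) : s <= u -> \int[mu]_(x in `]s, u]) k = k * (u - s).
Proof.
move=> su; rewrite Rintegral_cst//; congr (_ * _).
by rewrite -[RHS]/(fine (u - s)%:E) -mu_itv.
Qed.

Let iitv g s u : {within `[0, +oo[, continuous g} -> 0 <= s ->
  mu.-integrable `]s, u] (EFin \o g).
Proof.
move=> cg s0; apply: (integrableS _ _ _ (integrable_within u cg)) => //.
by move=> x /=; rewrite !in_itv/= => /andP[sx ->]; rewrite (le_trans s0)// ltW.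
Qed.

Let icst s u (k : R) : 0 <= s -> mu.-integrable `]s, u] (EFin \o cst k).
Proof.
move=> s0; apply: iitv => //.
by apply: continuous_subspaceT => x; exact: cst_continuous.
Qed.

Lemma le_primitive_increment g k s u : {within `[0, +oo[, continuous g} ->
  0 <= s -> s <= u -> (forall x, s <= x -> x <= u -> k <= g x) ->
  k * (u - s) <= primitive g u - primitive g s.
Proof.
move=> cg s0 su kg; rewrite primitive_increment// -len//.
apply: le_Rintegral => //; [exact: icst|exact: iitv|].
by move=> x /=; rewrite in_itv/= => /andP[sx xu]; rewrite kg// ltW.
Qed.

Lemma ge_primitive_increment g k s u : {within `[0, +oo[, continuous g} ->
  0 <= s -> s <= u -> (forall x, s <= x -> x <= u -> g x <= k) ->
  primitive g u - primitive g s <= k * (u - s).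
Proof.
move=> cg s0 su kg; rewrite primitive_increment// -len//.
apply: le_Rintegral => //; [exact: iitv|exact: icst|].
by move=> x /=; rewrite in_itv/= => /andP[sx xu]; rewrite kg// ltW.
Qed.

End Increments.

Section Path.
Variable R : realType.
Notation mu := (@lebesgue_measure R).
Variables (c q : R) (t a : R -> R).
Hypothesis c0 : 0 < c.
Hypotheses (ct : {within `[0, +oo[, continuous t})
  (ca : {within `[0, +oo[, continuous a}).
Hypotheses (tgt0 : forall s, 0 <= s -> 0 < t s)
  (a1 : forall s, 0 <= s -> 1 <= a s)
  (tE : forall s, 0 <= s -> t s = t 0 + primitive a s).

Let in0y (x : R) : `[0, +oo[%classic x -> 0 <= x.
Proof. by rewrite /= in_itv/= andbT. Qed.

Let cV : {within `[0, +oo[, continuous (fun s => (t s)^-1)}.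
Proof.
apply/subspace_continuousP => x x0; apply: cvgV.
  by rewrite gt_eqF// tgt0// in0y.
exact: (subspace_continuousP _ _).1 ct x x0.
Qed.

Let cav : {within `[0, +oo[, continuous (fun x => a x * (t x)^-1 ^+ 2)}.
Proof.
apply/subspace_continuousP => x x0; apply: cvgM.
  exact: (subspace_continuousP _ _).1 ca x x0.
by rewrite !expr2; apply: cvgM; exact: (subspace_continuousP _ _).1 cV x x0.
Qed.

(** The derivative of [t] is [a], so the integrand is the derivative of
    [- t^-1]. *)
Lemma primitive_inv_sqr s : 0 <= s ->
  primitive (fun x => a x * (t x)^-1 ^+ 2) s = (t 0)^-1 - (t s)^-1.
Proof.
rewrite le_eqVlt => /predU1P[<-|s0].
  by rewrite primitive_le0// subrr.
(* [t] is only known on the half-line; [G] extends it in a form to which the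
   fundamental theorem of calculus applies. *)
pose G x := t 0 + primitive a x.
have GE x : 0 <= x -> G x = t x by move=> x0; rewrite tE.
have oo (x u : R) : x \in `]0, u[ -> 0 < x by rewrite in_itv/= => /andP[].
have ccG x : 0 <= x -> {within `[0, x], continuous G}.
  move=> x0; apply: (@subspace_eq_continuous _ _ _ t).
    by move=> y; rewrite inE /= in_itv/= => /andP[y0 _]; exact/esym/GE.
  apply: continuous_subspaceW ct => y /=; rewrite !in_itv/= andbT.
  by case/andP.
have [ca0 _] := (continuous_within_itvcyP _ _).1 ca.
have dG (x : R) : 0 < x -> is_derive x 1 G (a x).
  move=> x0; have x0y : x \in `]0, +oo[ by rewrite in_itv/= x0.
  have [dp dpE] := @continuous_FTC1_closed R a 0 x (x + 1)
    (ltr_pwDr ltr01 (lexx _)) (integrable_within _ ca) x0 (ca0 x x0y).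
  rewrite /G -[a x]add0r; apply: is_deriveD.
  by apply: DeriveDef => //; rewrite -derive1E.
have [_ G0 Gs] := (continuous_within_itvP _ s0).1 (ccG s (ltW s0)).
pose H x := - (G x)^-1.
have HE (x : R) : 0 < x -> is_derive x 1 H (a x * (t x)^-1 ^+ 2).
  move=> x0; have Gn0 : G x != 0 by rewrite GE ?ltW// gt_eqF// tgt0// ltW.
  have := is_deriveN (is_deriveV Gn0 (dG x x0)).
  by rewrite /= scaleNr opprK GE ?ltW// /GRing.scale/= mulrC exprVn.
have Gn0 (x : R) : 0 <= x -> G x != 0 by move=> x0; rewrite GE// gt_eqF// tgt0.
have cf : {within `[0, s], continuous (fun x : R => a x * (t x)^-1 ^+ 2)}.
  apply: continuous_subspaceW cav.
  by move=> y /=; rewrite !in_itv/= andbT => /andP[].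
have dH : derivable_oo_LRcontinuous H 0 s.
  split.
  - by move=> x /oo x0; have := HE x x0; case.
  - by apply: cvgN; apply: cvgV => //; exact: Gn0.
  - by apply: cvgN; apply: cvgV => //; apply: Gn0; exact: ltW.
have H'E : {in `]0, s[, H^`()%classic =1 (fun x : R => a x * (t x)^-1 ^+ 2)}.
  by move=> x /oo x0; rewrite derive1E; have := HE x x0; case.
rewrite /primitive /Rintegral (continuous_FTC2 s0 cf dH H'E).
by rewrite -EFinB /= /H !GE// ?ltW// opprK addrC.
Qed.

Variable m : R -> R.
Hypothesis mE : forall s, 0 <= s -> a s = a 0 + m s +
  primitive (fun x => q * (a x * (t x)^-1 ^+ 2)
                      - c * (t x)^-1 * (a x ^+ 2 - 1)) s.

(* The part of the drift that pulls the velocity back to 1. *)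
Let friction x := c * (t x)^-1 * (a x ^+ 2 - 1).

Let cf : {within `[0, +oo[, continuous friction}.
Proof.
apply/subspace_continuousP => x x0; apply: cvgM.
  apply: cvgM; first exact: cvg_cst.
  exact: (subspace_continuousP _ _).1 cV x x0.
apply: cvgB; last exact: cvg_cst.
by rewrite expr2; apply: cvgM; exact: (subspace_continuousP _ _).1 ca x x0.
Qed.

Let friction_ge0 x : 0 <= x -> 0 <= friction x.
Proof.
move=> x0; apply: mulr_ge0; first by rewrite mulr_ge0 ?invr_ge0 ?ltW ?tgt0.
by rewrite subr_ge0 exprn_ege1// a1.
Qed.

(** The friction is moved to the left-hand side, where it adds up with [a] to a
    nonnegative quantity; the other drift term integrates in closed form. *)
Lemma balance s : 0 <= s ->
  a s + primitive friction s = a 0 + m s + q * ((t 0)^-1 - (t s)^-1).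
Proof.
move=> s0; rewrite {1}mE// -addrA; congr (_ + _).
rewrite -primitive_inv_sqr// /primitive RintegralB//.
- by rewrite subrK RintegralZl//; exact: (integrable_within _ cav).
- apply: integrable_within; apply/subspace_continuousP => x x0.
  apply: cvgM; first exact: cvg_cst.
  exact: (subspace_continuousP _ _).1 cav x x0.
- exact: (integrable_within _ cf).
Qed.

Lemma primitive_friction_homo : {homo primitive friction : s u / s <= u}.
Proof.
move=> s u su; have [s0|/ltW s0] := leP 0 s.
  rewrite -subr_ge0 -[leLHS](mul0r (u - s)).
  apply: le_primitive_increment => // x sx _.
  by rewrite friction_ge0// (le_trans s0).
rewrite [leLHS]primitive_le0//; apply: Rintegral_ge0 => x /=.
by rewrite in_itv/= => /andP[x0 _]; exact: friction_ge0.
Qed.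

(** This is where the sign of [q] matters: it makes the integral of the drift
    term [q a / t^2] at most [q / t 0]. *)
Lemma martingale_part_ge s : 0 <= q -> 0 <= s -> - (a 0 + q * (t 0)^-1) <= m s.
Proof.
move=> q0 s0; have := balance s0.
have := primitive_friction_homo s0; rewrite [leLHS]primitive_le0// => I0.
have := a1 s0.
have : 0 <= q * (t s)^-1 by rewrite mulr_ge0// invr_ge0 ltW// tgt0.
by move: I0; rewrite mulrBr; lra.
Qed.

Lemma time_cvgy : t s @[s --> +oo] --> +oo.
Proof.
apply/cvgryPge => A; near=> s.
have s0 : 0 <= s by near: s; exact: (nbhs_pinfty_ge (num_real _)).
have : 1 * (s - 0) <= primitive a s - primitive a 0.
  by apply: le_primitive_increment => // x x0 _; exact: a1.
rewrite [primitive a 0]primitive_le0// !subr0 mul1r => sI.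
rewrite tE//; apply: (@le_trans _ _ s).
  by near: s; exact: (nbhs_pinfty_ge (num_real _)).
by apply: (le_trans sI); rewrite lerDr ltW// tgt0.
Unshelve. all: by end_near. Qed.

(** By the balance identity the integral [I] of the friction is bounded, so it
    converges, and then so does [a], to some limit [L >= 1].  If [L > 1], then
    on [[s, 2s]] the friction is at least a constant times [1 / s], because [t]
    grows at most linearly; thus [I (2 * s) - I s] stays above a positive
    constant, which contradicts the convergence of [I]. *)
Lemma velocity_cvg1 (l : R) : m @ +oo --> l -> a @ +oo --> (1 : R).
Proof.
move=> ml.
have tV0 : (t s)^-1 @[s --> +oo] --> (0 : R).
  apply/gtr0_cvgV0; last exact: time_cvgy.
  by near=> s; apply: tgt0; near: s; exact: (nbhs_pinfty_ge (num_real _)).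
pose N s := a 0 + m s + q * ((t 0)^-1 - (t s)^-1).
have NL : N @ +oo --> a 0 + l + q * ((t 0)^-1 - 0).
  apply: cvgD; first by apply: cvgD => //; exact: cvg_cst.
  by apply: cvgM; [exact: cvg_cst|apply: cvgB => //; exact: cvg_cst].
set L0 := a 0 + l + _ in NL.
pose I := primitive friction.
have Nlt : \forall u \near +oo, N u < L0 + 1.
  by apply: (cvgr_lt _ NL); rewrite ltrDl.
have Iub : has_ubound (range I).
  have [M [_ NM]] := Nlt.
  exists (L0 + 1) => _ [s _ <-].
  pose u := Num.max (Num.max 0 s) (M + 1).
  have u0 : 0 <= u by rewrite !le_max lexx.
  have su : s <= u by rewrite !le_max lexx orbT.
  have Mu : M < u by rewrite lt_max ltrDl ltr01 orbT.
  apply: le_trans (primitive_friction_homo su) _.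
  have := NM _ Mu; have := balance u0; rewrite -/(N u) -/(I u).
  by have := a1 u0; lra.
have /= IL := nondecreasing_cvgr primitive_friction_homo Iub.
rewrite -/I in IL; set J := sup _ in IL.
have aL : a @ +oo --> L0 - J.
  have h : N s - I s @[s --> +oo] --> L0 - J by exact: cvgB.
  apply: cvg_trans h; apply: near_eq_cvg; near=> s.
  rewrite /N -balance ?addrK//; near: s; exact: (nbhs_pinfty_ge (num_real _)).
set L := L0 - J in aL.
have L1 : 1 <= L.
  rewrite leNgt; apply/negP => /(cvgr_lt _ aL)[M [_ aM]].
  pose s := Num.max 0 (M + 1).
  have s0 : 0 <= s by rewrite le_max lexx.
  have : a s < 1 by apply: aM; rewrite lt_max ltrDl ltr01 orbT.
  by rewrite ltNge a1.
suff -> : 1 = L by [].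
apply/eqP; rewrite eq_le L1 leNgt; apply/negP => {}L1.
pose r := (1 + L) / 2.
have r1 : 1 < r by rewrite /r; lra.
have rL : r < L by rewrite /r; lra.
have [s0 [_ ra]] := cvgr_gt _ aL _ rL.
have [s1 [_ aA]] := cvgr_lt _ aL (L + 1) (ltac:(by rewrite ltrDl)).
pose S := Num.max 1 (Num.max (s0 + 1) (s1 + 1)).
have S1 : 1 <= S by rewrite le_max lexx.
have S0 : 0 <= S := le_trans ler01 S1.
have Sr x : S <= x -> r <= a x.
  rewrite !ge_max => /and3P[_ sx _]; apply/ltW/ra; lra.
have SA x : S <= x -> a x <= L + 1.
  rewrite !ge_max => /and3P[_ _ sx]; apply/ltW/aA; lra.
(* From time S on, [a] lies between [r] and [L + 1]. *)
pose B := t S + (L + 1).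
have B0 : 0 < B by rewrite addr_gt0 ?tgt0//; lra.
have tB x : S <= x -> t x <= B * x.
  move=> Sx; have x0 := le_trans S0 Sx.
  have : primitive a x - primitive a S <= (L + 1) * (x - S).
    by apply: ge_primitive_increment => // y Sy _; exact: SA.
  have : t S * 1 <= t S * x by rewrite ler_pM2l ?tgt0// (le_trans S1).
  have : 0 <= (L + 1) * S by rewrite mulr_ge0//; lra.
  by rewrite /B mulrDl; have := tE x0; have := tE S0; lra.
(* On [[s, 2s]], [t] is at most [2 * B * s], so that the friction is at
   least [k / s]. *)
pose k := c * (r ^+ 2 - 1) / (2 * B).
have k0 : 0 < k.
  rewrite divr_gt0 ?mulr_gt0// subr_gt0 exprn_egt1//.
have Ik s : S <= s -> k <= I (2 * s) - I s.
  move=> Ss; have s_gt0 : 0 < s by apply: lt_le_trans ltr01 (le_trans S1 Ss).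
  rewrite [leLHS](_ : _ = (k / s) * (2 * s - s)); last by field; rewrite gt_eqF.
  apply: le_primitive_increment => //; [exact: ltW|lra|].
  move=> x sx xs; have Sx := le_trans Ss sx; have x0 := lt_le_trans s_gt0 sx.
  rewrite /friction /k.
  have -> : c * (r ^+ 2 - 1) / (2 * B) / s =
      c * (B * (2 * s))^-1 * (r ^+ 2 - 1).
    by field; rewrite !gt_eqF.
  apply: ler_pM.
  - by rewrite mulr_ge0 ?invr_ge0 ?mulr_ge0 ?ltW.
  - by rewrite subr_ge0 exprn_ege1// ltW.
  - rewrite ler_pM2l// lef_pV2 ?posrE ?mulr_gt0 ?tgt0 ?(ltW x0)//.
    by rewrite (le_trans (tB _ Sx))// ler_pM2l.
  - by rewrite lerD2r lerXn2r ?nnegrE ?Sr// ?(le_trans ler01) ?a1 ?ltW.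
have [s2 [_ IJ]] := cvgr_gt _ IL (J - k) (ltac:(by rewrite gtrBl)).
pose s := Num.max S (s2 + 1).
have Ss : S <= s by rewrite le_max lexx.
have s2s : s2 < s by rewrite lt_max ltrDl ltr01 orbT.
have := Ik s Ss; have := IJ _ s2s.
have : I (2 * s) <= J by apply: ub_le_sup => //; exists (2 * s).
lra.
Unshelve. all: by end_near. Qed.

End Path.

(** * The R-diffusion *)

(** The only Christoffel symbols involved are [c t^(2c-1)] on the spatial
    diagonal; the unit-length condition rewrites the spatial norm in terms of
    the time component. *)
Lemma R_drift_time (R : realType) (c rho : R) (xi v : 'rV[R]_4) :
  eds_unit_tangent c (xi, v) ->
  R_drift c rho ord0 xi v =
  9 * c * (2 * c - 1) * rho ^+ 2 * (v 0 ord0 * (time xi)^-1 ^+ 2)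
  - c * (time xi)^-1 * (v 0 ord0 ^+ 2 - 1).
Proof.
case=> /= t0 ht _; have tn0 : time xi != 0 by rewrite gt_eqF.
have p0 : time xi `^ (2 * c) != 0 by rewrite gt_eqF// powR_gt0.
rewrite /R_drift; congr (_ - _); first by field.
rewrite (bigD1 ord0)//= big1 ?add0r; last first.
  by move=> j _; rewrite christoffel_eds// /eds_gamma !eqxx /= !mul0r.
rewrite (eq_bigr (fun i : 'I_4 => c * time xi `^ (2 * c - 1) * v 0 i ^+ 2)).
  rewrite -mulr_sumr powRD ?tn0 ?implybT// powR_inv1 ?ltW//.
  by rewrite -[X in _ - X]ht; ring.
move=> i i0; rewrite (bigD1 i)//= big1 ?addr0.
  by rewrite christoffel_eds// /eds_gamma !eqxx i0 /=; ring.
move=> j ji; rewrite christoffel_eds// /eds_gamma !eqxx i0 /= eq_sym (negPf ji).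
by rewrite !mul0r.
Qed.

Lemma continuous_coord (R : realType) (f : R -> 'rV[R]_4) (A : set R)
    (k : 'I_4) :
  {within A, continuous f} -> {within A, continuous (fun s => f s 0 k)}.
Proof.
move=> /subspace_continuousP cf; apply/subspace_continuousP => x Ax.
exact: (cvg_comp _ _ (cf x Ax) (@coord_continuous R 1 4 0 k (f x))).
Qed.

Theorem proposition5p2p1 (R : realType) (d : measure_display)
    (T : measurableType d) (P : probability T R) (c rho : R)
    (F : R -> set (set T)) (p0 : 'rV[R]_4 * 'rV[R]_4)
    (X V : R -> T -> 'rV[R]_4)
    (hc : 2^-1 <= c) (hrho : 0 < rho) (hp0 : eds_unit_tangent c p0)
    (hXV : R_diffusion P c rho F p0 X V) :
  {ae P, forall w,
    ((V s w 0 ord0) @[s --> +oo] --> (1 : R)) /\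
    (energy (eds_metric c) (X s w) (V s w) @[s --> +oo] --> (0 : R))}.
Proof.
have [hF [tan [cX [cV [_ [_ [XV0 [XE [M [M0 cM _ VE]]]]]]]]]] := hXV.
have c0 : 0 < c by apply: lt_le_trans hc; rewrite invr_gt0.
pose q := 9 * c * (2 * c - 1) * rho ^+ 2.
have q0 : 0 <= q.
  rewrite /q mulr_ge0 ?sqr_ge0// mulr_ge0//; first by rewrite mulr_ge0// ltW.
  by rewrite subr_ge0 -ler_pdivrMl// mulr1.
pose t w s := X s w 0 ord0; pose a w s := V s w 0 ord0.
have ct w : {within `[0, +oo[, continuous (t w)} by exact: continuous_coord.
have ca w : {within `[0, +oo[, continuous (a w)} by exact: continuous_coord.
have tgt0 w s : 0 <= s -> 0 < t w s by move=> /(tan _ w)[].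
have a1 w s : 0 <= s -> 1 <= a w s by move=> /(tan _ w)[].
have tE : {ae P, forall w, forall s, 0 <= s ->
    t w s = t w 0 + primitive (a w) s}.
  by apply: filterS XE => w XEw s s0; exact: XEw.
have aE : {ae P, forall w, forall s, 0 <= s ->
    a w s = a w 0 + rho * M ord0 s w +
    primitive (fun x => q * (a w x * (t w x)^-1 ^+ 2)
                        - c * (t w x)^-1 * (a w x ^+ 2 - 1)) s}.
  apply: filterS VE => w VEw s s0; rewrite {1}/a VEw//; congr (_ + _).
  apply: eq_Rintegral => x; rewrite inE /= in_itv/= => /andP[x0 _].
  by rewrite R_drift_time//; exact: tan.
(* The lower bound is deterministic since the initial point is. *)
pose C := rho^-1 * (p0.2 0 ord0 + q * (p0.1 0 ord0)^-1).
have MC : {ae P, forall w, forall s, 0 <= s -> - C <= M ord0 s w}.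
  apply: filterS3 XV0 tE aE => w XVw tEw aEw s s0.
  have := @martingale_part_ge R c q (t w) (a w) c0 (ct w) (ca w) (tgt0 w)
    (a1 w) tEw (fun s => rho * M ord0 s w) aEw s q0 s0.
  move=> h; rewrite -(ler_pM2l hrho) mulrN /C mulVKf ?gt_eqF//.
  by move: h; rewrite /t /a -XVw.
have hY := bounded_below_local_martingale hF (cM ord0) (M0 ord0) MC.
have cY : continuous_paths (fun s w => `|M ord0 s w + C|).
  move=> w; have [_ cMw _] := cM ord0.
  apply/subspace_continuousP => x x0; apply: cvg_norm.
  apply: cvgD; last exact: cvg_cst.
  exact: (subspace_continuousP _ _).1 (cMw w) x x0.
have Ycvg := nonneg_supermartingale_cvg hF hY cY.
have MYcvg : {ae P, forall w, cvg ((rho * M ord0 s w) @[s --> +oo])}.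
  apply: filterS2 MC Ycvg => w MCw /cvg_ex[l Yl].
  apply/cvg_ex; exists (rho * (l - C)).
  apply: cvgM; first exact: cvg_cst.
  have h : `|M ord0 s w + C| - C @[s --> +oo] --> l - C.
    by apply: cvgB => //; exact: cvg_cst.
  apply: cvg_trans h; apply: near_eq_cvg; near=> s.
  have s0 : 0 <= s by near: s; exact: (nbhs_pinfty_ge (num_real _)).
  by rewrite ger0_norm ?addrK// -lerBlDr sub0r MCw.
apply: filterS3 tE aE MYcvg => w tEw aEw /cvg_ex[l ml].
have al : a w @ +oo --> (1 : R).
  exact: (velocity_cvg1 c0 (ct w) (ca w) (tgt0 w) (a1 w) tEw aEw ml).
have ty : t w @ +oo --> +oo := time_cvgy (ca w) (tgt0 w) (a1 w) tEw.
split; first exact: al.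
have tV0 : (t w s)^-1 @[s --> +oo] --> (0 : R).
  apply/gtr0_cvgV0; last exact: ty.
  by near=> s; apply: tgt0; near: s; exact: (nbhs_pinfty_ge (num_real _)).
have h : c * ((t w s)^-1 * (t w s)^-1) * (2 * (a w s * a w s) + 3 * c - 2)
    @[s --> +oo] --> c * (0 * 0) * (2 * (1 * 1) + 3 * c - 2).
  apply: cvgM; first by apply: cvgM; [exact: cvg_cst|exact: cvgM].
  apply: cvgB; last exact: cvg_cst.
  apply: cvgD; last exact: cvg_cst.
  by apply: cvgM; [exact: cvg_cst|exact: cvgM].
rewrite !mul0r mulr0 mul0r in h.
apply: cvg_trans h; apply: near_eq_cvg; near=> s.
have s0 : 0 <= s by near: s; exact: (nbhs_pinfty_ge (num_real _)).
rewrite energy_eds; last exact: tan.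
by rewrite /t /a /time !expr2 invfM.
Unshelve. all: by end_near. Qed.
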